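(* Let $h(x)$ be a polynomial with real coefficients, let $A$ be an arbitrary $(m+1)$-dimensional unitary algebra over $K$ ($K=\mathbb{R}$ or $\mathbb{C}$) with basis $\{e_0,e_1,\dots,e_m\}$, and let $Q_{h,n}(x)=\sum_{k=0}^{m}F_{h,n+k}(x)\,e_k$ ($n\ge 0$) be the $h(x)$-Fibonacci polynomials in $A$. Suppose that $n$ is a nonnegative integer and $r$ is a natural number. Then for $r>n$, $$Q_{h,r}(x)\,Q_{h,n+1}(x)-Q_{h,r+1}(x)\,Q_{h,n}(x)=\frac{(-1)^{n}}{\alpha(x)-\beta(x)}\Bigl(\alpha^{\ast}(x)\beta^{\ast}(x)\,\alpha^{r-n}(x)-\beta^{\ast}(x)\alpha^{\ast}(x)\,\beta^{r-n}(x)\Bigr).$$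
   Context: The real $h(x)$-Fibonacci polynomials $F_{h,n}(x)$ are defined by $F_{h,0}(x)=0$, $F_{h,1}(x)=1$ and $F_{h,n}(x)=h(x)F_{h,n-1}(x)+F_{h,n-2}(x)$ for $n\ge 2$. The scalars $$\alpha(x)=\frac{h(x)+\sqrt{h^{2}(x)+4}}{2},\qquad \beta(x)=\frac{h(x)-\sqrt{h^{2}(x)+4}}{2}$$ are the roots of $v^{2}-h(x)v-1=0$, and $\alpha^{\ast}(x)=\sum_{k=0}^{m}\alpha^{k}(x)\,e_k\in A$, $\beta^{\ast}(x)=\sum_{k=0}^{m}\beta^{k}(x)\,e_k\in A$. Powers such as $\alpha^k(x)$ mean $(\alpha(x))^k$; products of elements of $A$ are taken in $A$. The variable $x$ is real. The algebra $A$ has a unit and a $K$-bilinear product; it is not assumed associative or commutative. *)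

(* Defs.v *)
From HB Require Import structures.
From mathcomp Require Import all_boot all_order all_algebra.
From mathcomp Require Import sesquilinear.
From mathcomp Require Import reals.
From mathcomp Require Import complex.

Set Implicit Arguments.
Unset Strict Implicit.
Unset Printing Implicit Defensive.

Import Order.TTheory GRing.Theory Num.Theory.
Local Open Scope ring_scope.

Inductive ground := Reals | Complexes.

Definition scalars (R : realType) (g : ground) : fieldType :=
  match g with
  | Reals => R
  | Complexes => R[i]
  end.

Definition embed (R : realType) (g : ground) : {rmorphism R -> scalars R g} :=
  match g with
  | Reals => idfun
  | Complexes => real_complex R
  end.

Fixpoint hfib (R : realType) (h : {poly R}) (n : nat) {struct n} : {poly R} :=
  match n with
  | 0 => 0
  | 1 => 1
  | (n'.+1 as n1).+1 => h * hfib h n1 + hfib h n'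
  end.

Definition alpha (R : realType) (h : {poly R}) (x : R) : R :=
  (h.[x] + Num.sqrt (h.[x] ^+ 2 + 4)) / 2.

Definition beta (R : realType) (h : {poly R}) (x : R) : R :=
  (h.[x] - Num.sqrt (h.[x] ^+ 2 + 4)) / 2.

Section InAlgebra.

Variables (R : realType) (g : ground) (A : vectType (scalars R g)) (m : nat).
Variables (e : m.+1.-tuple A) (h : {poly R}).

Definition Qhfib (n : nat) (x : R) : A :=
  \sum_(k < m.+1) embed R g (hfib h (n + k)).[x] *: tnth e k.

Definition alpha_star (x : R) : A :=
  \sum_(k < m.+1) embed R g (alpha h x ^+ k) *: tnth e k.

Definition beta_star (x : R) : A :=
  \sum_(k < m.+1) embed R g (beta h x ^+ k) *: tnth e k.

End InAlgebra.

(* Main.v *)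
(** Binet's formula [F_n = (alpha^n - beta^n) / (alpha - beta)] lifts to
    [Q_n = (alpha^n alpha* - beta^n beta* ) / (alpha - beta)]. In the difference
    of products the [alpha* alpha*] and [beta* beta*] terms cancel, and
    [alpha beta = -1] simplifies the coefficients of the two mixed terms. *)
Require Import Defs.
From mathcomp Require Import all_boot all_order all_algebra.
From mathcomp Require Import sesquilinear reals complex.
From mathcomp Require Import ring.

Import GRing.Theory Num.Theory.
Local Open Scope ring_scope.

Section Roots.

Variables (R : realType) (h : {poly R}) (x : R).

Lemma alpha_sub_beta : alpha h x - beta h x = Num.sqrt (h.[x] ^+ 2 + 4).
Proof. by rewrite /alpha /beta; field. Qed.

(** The radicand is at least 4 at every real [x], so later inverses of this difference are genuine,
    not the default [0^-1 = 0]. *)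
Lemma alpha_sub_beta_neq0 : alpha h x - beta h x != 0.
Proof.
by rewrite alpha_sub_beta lt0r_neq0 // sqrtr_gt0 ltr_wpDl ?sqr_ge0 ?ltr0n.
Qed.

Lemma alpha_add_beta : alpha h x + beta h x = h.[x].
Proof. by rewrite /alpha /beta; field. Qed.

Lemma alpha_mul_beta : alpha h x * beta h x = -1.
Proof.
have s2 : Num.sqrt (h.[x] ^+ 2 + 4) ^+ 2 = h.[x] ^+ 2 + 4.
  by rewrite sqr_sqrtr // addr_ge0 ?sqr_ge0 ?ler0n.
by rewrite /alpha /beta; field: s2.
Qed.

Lemma hfib_binet n :
  (hfib h n).[x] = (alpha h x - beta h x)^-1 * (alpha h x ^+ n - beta h x ^+ n).
Proof.
have dn0 := alpha_sub_beta_neq0.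
(* Clearing the denominator keeps the induction free of division. *)
suff: (hfib h n).[x] * (alpha h x - beta h x) = alpha h x ^+ n - beta h x ^+ n.
  by move=> <-; rewrite mulrC mulfK.
elim/ltn_ind: n => -[|[|n]] IH; first by rewrite horner0 !expr0 mul0r subrr.
  by rewrite hornerC mul1r !expr1.
rewrite [hfib _ _]/= -/(hfib h n.+1) hornerD hornerM mulrDl -mulrA !IH //.
(* With [h.[x] = a + b], the cross terms of [(a + b) * (a ^+ n.+1 - b ^+ n.+1)] amount to
   [a * b * (a ^+ n - b ^+ n)], which cancels the older term because [a * b = -1]. *)
rewrite -alpha_add_beta !exprS.
have := alpha_mul_beta; set a := alpha h x; set b := beta h x => ab.
by ring: ab.
Qed.

End Roots.

(** Abstract form of the theorem: [s], [t] stand for the two roots, [p], [q] for their [r]-th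
    powers, [p'], [q'] for their [n]-th powers, and [c] for the inverse of the difference of the
    roots. *)
Lemma bilinear_exchange (K : fieldType) (A : lmodType K)
    (mul : {bilinear A -> A -> A}) (a b : A) (c s t p q p' q' : K) :
  mul (c *: (p *: a - q *: b)) (c *: ((s * p') *: a - (t * q') *: b))
    - mul (c *: ((s * p) *: a - (t * q) *: b)) (c *: (p' *: a - q' *: b))
  = (c * c * (s - t)) *: ((p * q') *: mul a b - (q * p') *: mul b a).
Proof.
rewrite !linearZl_LR !linearZr_LR /= !scalerA -scalerBr -[in RHS]scalerA.
congr (_ *: _).
rewrite !linearBl !linearBr /= !linearZl_LR !linearZr_LR /= !scalerBr !scalerA.
rewrite -!mulrA !(mulrCA _ s) !(mulrCA _ t) !mulrBl !scalerBl.
(* Grouping by left factor makes [mul a a] cancel within the first group and [mul b b] within the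
   second. *)
rewrite [- (_ *: mul a a - _ - _)]opprD addrACA -opprD; congr (_ - _); last first.
  by rewrite opprB addrA subrK.
by rewrite opprB addrC addrA subrK.
Qed.

Lemma Qhfib_binet (R : realType) (g : ground) (A : vectType (scalars R g))
    (m : nat) (e : m.+1.-tuple A) (h : {poly R}) (n : nat) (x : R) :
  Qhfib e h n x =
    embed R g (alpha h x - beta h x)^-1 *:
      (embed R g (alpha h x ^+ n) *: alpha_star e h x
       - embed R g (beta h x ^+ n) *: beta_star e h x).
Proof.
rewrite /Qhfib /alpha_star /beta_star !scaler_sumr -sumrB scaler_sumr.
apply: eq_bigr => k _.
by rewrite hfib_binet !scalerA -scalerBl scalerA -!rmorphM -rmorphB -rmorphM !exprD.
Qed.

Theorem theorem3p11 (R : realType) (g : ground) (h : {poly R}) (m : nat)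
    (A : vectType (scalars R g)) (mul : {bilinear A -> A -> A}) (one : A)
    (mul1a : left_id one mul) (mula1 : right_id one mul)
    (e : m.+1.-tuple A) (e_basis : basis_of fullv e)
    (n r : nat) (n_lt_r : (n < r)%N) (x : R) :
  mul (Qhfib e h r x) (Qhfib e h n.+1 x)
    - mul (Qhfib e h r.+1 x) (Qhfib e h n x)
  = embed R g ((-1) ^+ n / (alpha h x - beta h x)) *:
      (embed R g (alpha h x ^+ (r - n)) *:
         mul (alpha_star e h x) (beta_star e h x)
       - embed R g (beta h x ^+ (r - n)) *:
         mul (beta_star e h x) (alpha_star e h x)).
Proof.
have embedXS y k : embed R g (y ^+ k.+1) = embed R g y * embed R g (y ^+ k).
  by rewrite exprS rmorphM.
rewrite !Qhfib_binet !embedXS bilinear_exchange.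
(* Since [c] inverts [s - t], the scalar [c * c * (s - t)] collapses to [c]. *)
rewrite -!rmorphB -!rmorphM /= -mulrA mulVf ?alpha_sub_beta_neq0 // mulr1.
(* Splitting off [y ^+ n] pairs it with the [n]-th power of the other root, giving [(-1) ^+ n]; as
   [n < r], the subtraction [r - n] is not truncated. *)
have splitXr (y : R) : y ^+ r = y ^+ (r - n) * y ^+ n.
  by rewrite -exprD subnK // ltnW.
rewrite !splitXr -!mulrA -!exprMn.
rewrite [beta h x * _]mulrC alpha_mul_beta [_ / _]mulrC.
rewrite 3!rmorphM -!scalerA; congr (_ *: _).
by rewrite [RHS]scalerBr; congr (_ - _); rewrite !scalerA mulrC.
Qed.
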